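(* For all integers $n\ge 0$ and $m\ge 0$, $$\big([m]_{f}(\alpha_{0})\big)^{n}=\sum_{l=0}^{n}{n \brace l}_{f}(\alpha_{m})\,\big([m]_{f}(\alpha_{0})\big)_{l}.$$
   Context: The generalized Heisenberg algebra $\mathrm{GHA}_f$ is generated by $\{a,a^{\dagger},H\}$ with relations $$aH=f(H)a,\qquad Ha^{\dagger}=a^{\dagger}f(H),\qquad [a,a^{\dagger}]=aa^{\dagger}-a^{\dagger}a=f(H)-H,$$ where $H$ is the self-conjugate Hamiltonian and $f$ is an analytic function (the characteristic function) with compositional inverse $f^{-1}$. For a positive integer $k$, $f^{k}$ is the $k$-fold composition of $f$, $f^{-k}$ is the $k$-fold composition of $f^{-1}$, and $f^{0}$ is the identity. For $k\in\mathbb{Z}$, $[k]_f(x)=f^{k}(x)-x$. Fock representation: the orthonormal number states $\{|n\rangle\}_{n\ge 0}$ form a basis of eigenstates of $H$, $H|m\rangle=\alpha_m|m\rangle$, where $\alpha_0$ is the eigenvalue of the vacuum $|0\rangle$ and $\alpha_m=f^{m}(\alpha_0)$. The operators $a$ and $a^\dagger$ (adjoint to each other) act by $$a|m\rangle=\sqrt{[m]_f(\alpha_0)}\,|m-1\rangle\ (m\ge1),\quad a|0\rangle=0,\quad a^{\dagger}|m\rangle=\sqrt{[m+1]_f(\alpha_0)}\,|m+1\rangle\ (m\ge0),$$ where $[m]_f(\alpha_0)>0$ for all $m\ge1$. The generalized number operator is $N_f=a^{\dagger}a$. The generalized Stirling operators of the second kind ${n \brace k}_f(H)$ (functions ${n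 \brace k}_f$ of one variable evaluated at $H$) are defined by the normal ordering identity in $\mathrm{GHA}_f$ $$N_f^{n}=(a^{\dagger}a)^{n}=\sum_{k=0}^{n}{n \brace k}_f(H)\,(a^{\dagger})^{k}a^{k}\qquad(n\ge0),$$ with ${n \brace 0}_f(H)=\delta_{n,0}$ and ${n \brace k}_f(H)=0$ if $k>n$. ${n \brace l}_f(\alpha_m)$ is the value of the function ${n \brace l}_f$ at $\alpha_m$. Generalized falling factorials: $\big([m]_f(\alpha_0)\big)_0=1$ and $\big([m]_f(\alpha_0)\big)_l=[m]_f(\alpha_0)[m-1]_f(\alpha_0)\cdots[m-l+1]_f(\alpha_0)$ for $l\ge1$ (which is $0$ for $l>m$, since $[0]_f(\alpha_0)=0$). *)

(* Defs.v *)
From HB Require Import structures.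
From mathcomp Require Import all_boot all_order all_algebra generic_quotient.
From mathcomp Require Import sesquilinear complex.
From mathcomp Require Import all_classical all_reals topology normedtype.
From mathcomp Require Import sequences.
Set Implicit Arguments.
Unset Strict Implicit.
Unset Printing Implicit Defensive.
Import Order.TTheory GRing.Theory Num.Theory.
Import numFieldTopology.Exports numFieldNormedType.Exports.
Local Open Scope classical_set_scope.
Local Open Scope quotient_scope.
Local Open Scope ring_scope.

(* The domain [D] is arbitrary, so that this covers both holomorphic functions
   on an open subset of the plane and real-analytic functions on an interval
   of the real line. *)
Definition analytic_on (K : numFieldType) (D : set K) (g : K -> K) : Prop :=
  forall z, D z -> exists c : nat -> K, exists2 r : K, 0 < r &
    forall w, D w -> `|w - z| < r ->
      [series c i * (w - z) ^+ i]_i @ \oo --> (g w : K^o).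

(* The characteristic function, analytic with an analytic compositional
   inverse.  It need not map its domain onto itself: the inverse is only
   constrained on the range, as for f x = (sqrt x + 1) ^ 2 on the positive
   half line. *)
Record charFun (K : numFieldType) := CharFun {
  cf_dom : set K;
  cf :> K -> K;
  cf_inv : K -> K;
  cf_stable : forall x, cf_dom x -> cf_dom (cf x);
  cf_analytic : analytic_on cf_dom cf;
  cf_inv_analytic : analytic_on (cf @` cf_dom) cf_inv;
  cf_invK : forall x, cf_dom x -> cf_inv (cf x) = x
}.

Definition fiter (K : numFieldType) (f : charFun K) (k : int) : K -> K :=
  match k with
  | Posz n => iter n f
  | Negz n => iter n.+1 (cf_inv f)
  end.

Definition bracket (K : numFieldType) (f : charFun K) (k : int) (x : K) : K :=
  fiter f k x - x.

Definition gen_ffact (K : numFieldType) (f : charFun K) (x : K) (m l : nat) : K :=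
  \prod_(i < l) bracket f (m%:Z - i%:Z) x.

(* The functions of one variable that may be evaluated at H. *)
Record hfun (K : numFieldType) (f : charFun K) := HFun {
  hf :> K -> K;
  hf_analytic : analytic_on (cf_dom f) hf
}.

Lemma analytic_on_id (K : numFieldType) (D : set K) : analytic_on D id.
Proof.
move=> z Dz; exists (fun i => if i == 0 then z else (i == 1)%:R), 1 => // w Dw _.
apply: (@cvg_near_cst _ K^o).
exists 2%N => // -[//|[//|n]] _.
apply/eqP; rewrite /series /= big_nat_recl// big_nat_recl//= big1_seq => [|i _].
  by rewrite mulr1 expr1 mul1r addr0 addrC subrK.
by rewrite mul0r.
Qed.

Definition hid (K : numFieldType) (f : charFun K) : hfun f :=
  HFun (@analytic_on_id K (cf_dom f)).

Definition hcf (K : numFieldType) (f : charFun K) : hfun f :=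
  HFun (@cf_analytic K f).

Section GeneralizedHeisenbergAlgebra.
Variables (K : numFieldType) (f : charFun K).
Local Notation D := (cf_dom f).

(* Ring expressions in a, a^dagger and the elements g(H).  Scalars need no
   constructor: they are the constant functions of H, which commute with a and
   a^dagger by [gha_rel_a] and [gha_rel_ad]. *)
Inductive gha_term : Type :=
| gha_ta
| gha_tad
| gha_tfun of hfun f
| gha_t0
| gha_t1
| gha_topp of gha_term
| gha_tadd of gha_term & gha_term
| gha_tmul of gha_term & gha_term.

(* The relations are imposed for all g(H), the relations with H alone being the
   case g = id.  Equations between functions are pointwise on the domain. *)
Inductive gha_rel : gha_term -> gha_term -> Prop :=
| gha_rel_refl t : gha_rel t t
| gha_rel_sym t u : gha_rel t u -> gha_rel u t
| gha_rel_trans t u v : gha_rel t u -> gha_rel u v -> gha_rel t v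
| gha_rel_opp t t' : gha_rel t t' -> gha_rel (gha_topp t) (gha_topp t')
| gha_rel_add t t' u u' : gha_rel t t' -> gha_rel u u' ->
    gha_rel (gha_tadd t u) (gha_tadd t' u')
| gha_rel_mul t t' u u' : gha_rel t t' -> gha_rel u u' ->
    gha_rel (gha_tmul t u) (gha_tmul t' u')
| gha_rel_addA t u v :
    gha_rel (gha_tadd t (gha_tadd u v)) (gha_tadd (gha_tadd t u) v)
| gha_rel_addC t u : gha_rel (gha_tadd t u) (gha_tadd u t)
| gha_rel_add0 t : gha_rel (gha_tadd gha_t0 t) t
| gha_rel_addN t : gha_rel (gha_tadd (gha_topp t) t) gha_t0
| gha_rel_mulA t u v :
    gha_rel (gha_tmul t (gha_tmul u v)) (gha_tmul (gha_tmul t u) v)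
| gha_rel_mul1l t : gha_rel (gha_tmul gha_t1 t) t
| gha_rel_mul1r t : gha_rel (gha_tmul t gha_t1) t
| gha_rel_mulDl t u v : gha_rel (gha_tmul (gha_tadd t u) v)
    (gha_tadd (gha_tmul t v) (gha_tmul u v))
| gha_rel_mulDr t u v : gha_rel (gha_tmul t (gha_tadd u v))
    (gha_tadd (gha_tmul t u) (gha_tmul t v))
| gha_rel_fun1 (g : hfun f) : (forall x, D x -> g x = 1) ->
    gha_rel (gha_tfun g) gha_t1
| gha_rel_funD (g h k : hfun f) : (forall x, D x -> k x = g x + h x) ->
    gha_rel (gha_tfun k) (gha_tadd (gha_tfun g) (gha_tfun h))
| gha_rel_funM (g h k : hfun f) : (forall x, D x -> k x = g x * h x) ->
    gha_rel (gha_tfun k) (gha_tmul (gha_tfun g) (gha_tfun h))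
| gha_rel_a (g h : hfun f) : (forall x, D x -> h x = g (f x)) ->
    gha_rel (gha_tmul gha_ta (gha_tfun g)) (gha_tmul (gha_tfun h) gha_ta)
| gha_rel_ad (g h : hfun f) : (forall x, D x -> h x = g (f x)) ->
    gha_rel (gha_tmul (gha_tfun g) gha_tad) (gha_tmul gha_tad (gha_tfun h))
| gha_rel_comm :
    gha_rel (gha_tadd (gha_tmul gha_ta gha_tad)
                      (gha_topp (gha_tmul gha_tad gha_ta)))
            (gha_tadd (gha_tfun (hcf f)) (gha_topp (gha_tfun (hid f)))).

HB.instance Definition _ := gen_eqMixin gha_term.
HB.instance Definition _ := gen_choiceMixin gha_term.

Definition gha_relb (t u : gha_term) : bool := `[< gha_rel t u >].

Lemma gha_relb_equiv : equiv_class_of gha_relb.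
Proof.
split=> [t|t u|t u v].
- exact/asboolP/gha_rel_refl.
- by apply/asboolP/asboolP; apply: gha_rel_sym.
- by move=> /asboolP tu /asboolP uv; apply/asboolP; apply: gha_rel_trans uv.
Qed.

Canonical gha_equiv := EquivRelPack gha_relb_equiv.

Definition GHA := {eq_quot gha_equiv}.
HB.instance Definition _ := Choice.on GHA.
HB.instance Definition _ := EqQuotient.on GHA.

Definition gha_pi (t : gha_term) : GHA := \pi_GHA t.

Lemma gha_piP t u : gha_rel t u -> gha_pi t = gha_pi u.
Proof. by move=> tu; apply/eqquotP/asboolP. Qed.

Lemma gha_piW (P : GHA -> Prop) : (forall t, P (gha_pi t)) -> forall x, P x.
Proof. by move=> Ppi x; rewrite -[x]reprK; apply: Ppi. Qed.

Lemma gha_repr t : gha_rel (repr (gha_pi t)) t.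
Proof.
apply/asboolP; apply/(@eqquotP _ _ GHA); exact: reprK (gha_pi t). Qed.

Definition gha_opp (x : GHA) : GHA := gha_pi (gha_topp (repr x)).
Definition gha_add (x y : GHA) : GHA := gha_pi (gha_tadd (repr x) (repr y)).
Definition gha_mul (x y : GHA) : GHA := gha_pi (gha_tmul (repr x) (repr y)).

Lemma gha_oppE t : gha_opp (gha_pi t) = gha_pi (gha_topp t).
Proof. exact/gha_piP/gha_rel_opp/gha_repr. Qed.

Lemma gha_addE t u : gha_add (gha_pi t) (gha_pi u) = gha_pi (gha_tadd t u).
Proof. by apply/gha_piP/gha_rel_add; apply: gha_repr. Qed.

Lemma gha_mulE t u : gha_mul (gha_pi t) (gha_pi u) = gha_pi (gha_tmul t u).
Proof. by apply/gha_piP/gha_rel_mul; apply: gha_repr. Qed.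

Let gha_opE := (gha_oppE, gha_addE, gha_mulE).

Fact gha_addA : associative gha_add.
Proof.
by elim/gha_piW=> t; elim/gha_piW=> u; elim/gha_piW=> v; rewrite !gha_opE;
  apply/gha_piP/gha_rel_addA.
Qed.

Fact gha_addC : commutative gha_add.
Proof.
by elim/gha_piW=> t; elim/gha_piW=> u; rewrite !gha_opE; apply/gha_piP/gha_rel_addC.
Qed.

Fact gha_add0 : left_id (gha_pi gha_t0) gha_add.
Proof. by elim/gha_piW=> t; rewrite !gha_opE; apply/gha_piP/gha_rel_add0. Qed.

Fact gha_addN : left_inverse (gha_pi gha_t0) gha_opp gha_add.
Proof. by elim/gha_piW=> t; rewrite !gha_opE; apply/gha_piP/gha_rel_addN. Qed.

HB.instance Definition _ :=
  GRing.isZmodule.Build GHA gha_addA gha_addC gha_add0 gha_addN.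

Fact gha_mulA : associative gha_mul.
Proof.
by elim/gha_piW=> t; elim/gha_piW=> u; elim/gha_piW=> v; rewrite !gha_opE;
  apply/gha_piP/gha_rel_mulA.
Qed.

Fact gha_mul1l : left_id (gha_pi gha_t1) gha_mul.
Proof. by elim/gha_piW=> t; rewrite !gha_opE; apply/gha_piP/gha_rel_mul1l. Qed.

Fact gha_mul1r : right_id (gha_pi gha_t1) gha_mul.
Proof. by elim/gha_piW=> t; rewrite !gha_opE; apply/gha_piP/gha_rel_mul1r. Qed.

Fact gha_mulDl : left_distributive gha_mul +%R.
Proof.
by elim/gha_piW=> t; elim/gha_piW=> u; elim/gha_piW=> v;
  rewrite /GRing.add /= !gha_opE; apply/gha_piP/gha_rel_mulDl.
Qed.

Fact gha_mulDr : right_distributive gha_mul +%R.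
Proof.
by elim/gha_piW=> t; elim/gha_piW=> u; elim/gha_piW=> v;
  rewrite /GRing.add /= !gha_opE; apply/gha_piP/gha_rel_mulDr.
Qed.

HB.instance Definition _ := GRing.Zmodule_isPzRing.Build GHA
  gha_mulA gha_mul1l gha_mul1r gha_mulDl gha_mulDr.

Definition gha_a : GHA := gha_pi gha_ta.
Definition gha_ad : GHA := gha_pi gha_tad.
Definition gha_fun (g : hfun f) : GHA := gha_pi (gha_tfun g).
Definition gha_H : GHA := gha_fun (hid f).
Definition gha_N : GHA := gha_ad * gha_a.

Lemma gha_aH : gha_a * gha_H = gha_fun (hcf f) * gha_a.
Proof.
by rewrite /GRing.mul /= !gha_opE; apply/gha_piP/gha_rel_a.
Qed.

Lemma gha_Had : gha_H * gha_ad = gha_ad * gha_fun (hcf f).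
Proof.
by rewrite /GRing.mul /= !gha_opE; apply/gha_piP/gha_rel_ad.
Qed.

Lemma gha_comm : gha_a * gha_ad - gha_ad * gha_a = gha_fun (hcf f) - gha_H.
Proof.
rewrite /gha_a /gha_ad /gha_H /gha_fun /GRing.mul /GRing.opp /GRing.add /= !gha_opE.
exact/gha_piP/gha_rel_comm.
Qed.

(* [S n k] is the generalized Stirling function of the second kind {n, k}_f. *)
Record is_stirling2 (S : nat -> nat -> hfun f) : Prop := IsStirling2 {
  stirling2_n0 : forall n x, D x -> S n 0%N x = (n == 0)%:R;
  stirling2_small : forall n k x, (n < k)%N -> D x -> S n k x = 0;
  stirling2_normal_order : forall n,
    gha_N ^+ n = \sum_(k < n.+1) gha_fun (S n k) * (gha_ad ^+ k * gha_a ^+ k)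
}.

End GeneralizedHeisenbergAlgebra.

(* The space is the domain of finite combinations of number states, on which
   the unbounded operators act. *)
Record fockRep (R : realType) (f : charFun R[i]) := FockRep {
  fock_space : lmodType R[i];
  fock_dot : {dot fock_space for Num.conj};
  ket : nat -> fock_space;
  fock_H : {linear fock_space -> fock_space};
  fock_a : {linear fock_space -> fock_space};
  fock_ad : {linear fock_space -> fock_space};
  fock_alpha : nat -> R[i];
  ket_orthonormal : forall m n, fock_dot (ket m) (ket n) = (m == n)%:R;
  ket_span : forall v, exists n (c : nat -> R[i]),
    v = \sum_(k < n) c k *: ket k;
  fock_H_adjoint : forall u v,
    fock_dot (fock_H u) v = fock_dot u (fock_H v);
  fock_a_adjoint : forall u v,
    fock_dot (fock_a u) v = fock_dot u (fock_ad v);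
  fock_alpha0_dom : cf_dom f (fock_alpha 0%N);
  fock_alphaE : forall m, fock_alpha m = fiter f m (fock_alpha 0%N);
  fock_bracket_gt0 : forall m : nat,
    (0 < m)%N -> 0 < bracket f m (fock_alpha 0%N);
  fock_H_ket : forall m, fock_H (ket m) = fock_alpha m *: ket m;
  fock_a_ket0 : fock_a (ket 0%N) = 0;
  fock_a_ket : forall m,
    fock_a (ket m.+1) = sqrtC (bracket f m.+1 (fock_alpha 0%N)) *: ket m;
  fock_ad_ket : forall m,
    fock_ad (ket m) = sqrtC (bracket f m.+1 (fock_alpha 0%N)) *: ket m.+1
}.

(* Main.v *)
Require Import Defs.
From mathcomp Require Import all_boot all_order all_algebra.
From mathcomp Require Import complex all_reals.
From mathcomp Require Import boolp.
Set Implicit Arguments.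
Unset Strict Implicit.
Unset Printing Implicit Defensive.
Import GRing.Theory.
Local Open Scope ring_scope.

(** The identity is the normal ordering identity of [GHA f], read off in a
    representation where all its terms are diagonal.

    In the basis |m) proportional to the number states, normalized so that
    a |m) = [m] |m-1) and a^dagger |m) = |m+1), no square root occurs, and
    (a^dagger)^l a^l multiplies |m) by [m] [m-1] ... [m-l+1], which is the
    generalized falling factorial; g(H) multiplies it by g(alpha_m).  So
    N_f^n multiplies |m) by [m]^n, and its normally ordered form multiplies
    |m) by the right-hand side.

    Since [GHA f] is a quotient of ring expressions, the representation is
    first an interpretation [term_act] of expressions; [term_act_rel] checks
    that it respects the defining relations, the essential one being that
    [m+1] - [m] = f(alpha_m) - alpha_m, and [gha_act] is the induced action of
    [GHA f].  The algebra acts on all sequences of coefficients in the basis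
    |m), including infinite ones, so that applying both sides to the sequence
    constantly equal to 1 yields all the eigenvalues at once
    ([bracket_exp_stirling2]). *)

Section FockAction.
Variables (K : numFieldType) (f : charFun K) (x : K).
Hypothesis Dx : cf_dom f x.

Implicit Types (v : nat -> K) (t u : gha_term f) (y z : GHA f).

Lemma iter_cf_dom m : cf_dom f (iter m f x).
Proof. by elim: m => //= m; apply: cf_stable. Qed.

Lemma bracket0 : bracket f 0 x = 0.
Proof. by rewrite /bracket /= subrr. Qed.

(** When l > m the product runs into negative brackets, but only after the
    factor [0] = 0. *)
Lemma gen_ffact_gt m l : (m < l)%N -> gen_ffact f x m l = 0.
Proof.
move=> ml; rewrite /gen_ffact (bigD1 (Ordinal ml)) //=.
by rewrite subrr bracket0 mul0r.
Qed.

Lemma gen_ffactS m l :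
  gen_ffact f x m.+1 l.+1 = bracket f m.+1 x * gen_ffact f x m l.
Proof.
rewrite /gen_ffact big_ord_recl /= subr0; congr (_ * _).
apply: eq_bigr => i _; rewrite /bump /=.
by rewrite add1n -[m.+1]addn1 -[i.+1]addn1 !PoszD opprD addrACA subrr addr0.
Qed.

Definition lower v : nat -> K := fun m => bracket f m.+1 x * v m.+1.

Definition raise v : nat -> K := fun m => if m is m'.+1 then v m' else 0.

Fixpoint term_act t v : nat -> K :=
  match t with
  | gha_ta => lower v
  | gha_tad => raise v
  | gha_tfun g => fun m => g (iter m f x) * v m
  | gha_t0 => fun=> 0
  | gha_t1 => v
  | gha_topp t => fun m => - term_act t v m
  | gha_tadd t u => fun m => term_act t v m + term_act u v m
  | gha_tmul t u => term_act t (term_act u v)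
  end.

(** Multiplication being interpreted as composition, this is what makes the
    relation t (u + w) = t u + t w hold. *)
Lemma term_act_add t v w :
  term_act t (fun m => v m + w m) = fun m => term_act t v m + term_act t w m.
Proof.
elim: t v w => [||g|||t IHt|t IHt u IHu|t IHt u IHu] v w //=.
- by apply/funext => m; rewrite /lower mulrDr.
- by apply/funext => -[|m] //=; rewrite addr0.
- by apply/funext => m; rewrite mulrDr.
- by apply/funext => m; rewrite addr0.
- by rewrite IHt; apply/funext => m; rewrite opprD.
- by rewrite IHt IHu; apply/funext => m; rewrite addrACA.
- by rewrite IHu IHt.
Qed.

(** The relation between a and a^dagger says that the increment of the
    bracket at m is f(alpha_m) - alpha_m; at m = 0 it also uses [0] = 0.  The
    relations involving functions of H are only given on the domain of f, and
    they can be used because the domain contains every alpha_m. *)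
Lemma term_act_rel t u : gha_rel t u -> term_act t = term_act u.
Proof.
elim=> {t u}.
- by [].
- by move=> t u _ ->.
- by move=> t u w _ -> _ ->.
- by move=> t t' _ /= ->.
- by move=> t t' u u' _ /= -> _ ->.
- by move=> t t' u u' _ /= -> _ ->.
- by move=> t u w; apply/funext => v; apply/funext => m /=; rewrite addrA.
- by move=> t u; apply/funext => v; apply/funext => m /=; rewrite addrC.
- by move=> t; apply/funext => v; apply/funext => m /=; rewrite add0r.
- by move=> t; apply/funext => v; apply/funext => m /=; rewrite addNr.
- by [].
- by [].
- by [].
- by [].
- by move=> t u w; apply/funext => v /=; rewrite term_act_add.
- move=> g g1; apply/funext => v; apply/funext => m /=.
  by rewrite g1 ?mul1r //; apply: iter_cf_dom.
- move=> g h k kE; apply/funext => v; apply/funext => m /=.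
  by rewrite kE ?mulrDl //; apply: iter_cf_dom.
- move=> g h k kE; apply/funext => v; apply/funext => m /=.
  by rewrite kE ?mulrA //; apply: iter_cf_dom.
- move=> g h hE; apply/funext => v; apply/funext => m /=.
  by rewrite /lower mulrCA hE //; apply: iter_cf_dom.
- move=> g h hE; apply/funext => v; apply/funext => -[|m] /=.
    by rewrite mulr0.
  by rewrite hE //; apply: iter_cf_dom.
- apply/funext => v; apply/funext => -[|m] /=; rewrite /lower /bracket /=.
    by rewrite oppr0 addr0 mulrBl.
  by rewrite -!mulNr -!mulrDl opprB addrA subrK.
Qed.

Definition gha_act y : (nat -> K) -> nat -> K := term_act (repr y).

Lemma gha_act_pi t : gha_act (gha_pi t) = term_act t.
Proof. exact/term_act_rel/gha_repr. Qed.

Lemma gha_act0 v m : gha_act 0 v m = 0.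
Proof. by rewrite [0]/(gha_pi _) gha_act_pi. Qed.

Lemma gha_act1 v : gha_act 1 v = v.
Proof. by rewrite [1]/(gha_pi _) gha_act_pi. Qed.

Lemma gha_actD y z v m : gha_act (y + z) v m = gha_act y v m + gha_act z v m.
Proof. by rewrite [y + z]/(gha_pi _) gha_act_pi. Qed.

Lemma gha_actM y z v : gha_act (y * z) v = gha_act y (gha_act z v).
Proof. by rewrite [y * z]/(gha_pi _) gha_act_pi. Qed.

Lemma gha_act_sum n (y : 'I_n -> GHA f) v m :
  gha_act (\sum_(i < n) y i) v m = \sum_(i < n) gha_act (y i) v m.
Proof.
exact: (big_morph (fun z => gha_act z v m)
          (fun y z => gha_actD y z v m) (gha_act0 v m)).
Qed.

Lemma gha_act_fun g v m : gha_act (gha_fun g) v m = g (iter m f x) * v m.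
Proof. by rewrite gha_act_pi. Qed.

Lemma gha_act_N v m : gha_act (gha_N f) v m = bracket f m x * v m.
Proof.
by rewrite gha_actM !gha_act_pi; case: m => //=; rewrite bracket0 mul0r.
Qed.

Lemma gha_act_NX n v m : gha_act (gha_N f ^+ n) v m = bracket f m x ^+ n * v m.
Proof.
elim: n => [|n IHn]; first by rewrite !expr0 gha_act1 mul1r.
by rewrite !exprS gha_actM gha_act_N IHn mulrA.
Qed.

(** Peeling off the outermost a^dagger and the innermost a shifts m to
    m - 1, which matches the recursion of the falling factorial. *)
Lemma gha_act_ad_a l v m :
  gha_act (gha_ad f ^+ l * gha_a f ^+ l) v m = gen_ffact f x m l * v m.
Proof.
elim: l v m => [|l IHl] v m.
  by rewrite !expr0 mulr1 gha_act1 /gen_ffact big_ord0 mul1r.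
rewrite exprS exprSr mulrA -(mulrA (gha_ad f)) 2!gha_actM.
rewrite [gha_act (gha_ad f)]gha_act_pi [gha_act (gha_a f)]gha_act_pi.
case: m => [|m] /=; first by rewrite gen_ffact_gt ?mul0r.
by rewrite IHl gen_ffactS /lower mulrA [gen_ffact _ _ _ _ * _]mulrC.
Qed.

Lemma bracket_exp_stirling2 (S : nat -> nat -> hfun f) (n m : nat) :
  is_stirling2 S ->
  bracket f m x ^+ n =
  \sum_(l < n.+1) S n l (iter m f x) * gen_ffact f x m l.
Proof.
move=> HS; have := gha_act_NX n (fun=> 1) m.
rewrite mulr1 => <-; rewrite (stirling2_normal_order HS) gha_act_sum.
by apply: eq_bigr => l _; rewrite gha_actM gha_act_fun gha_act_ad_a mulr1.
Qed.

End FockAction.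

Theorem theorem3p2 (R : realType) (f : charFun R[i]) (F : fockRep f)
    (S : nat -> nat -> hfun f) (HS : is_stirling2 S) (n m : nat) :
  bracket f m (fock_alpha F 0) ^+ n =
  \sum_(l < n.+1) S n l (fock_alpha F m) * gen_ffact f (fock_alpha F 0) m l.
Proof.
rewrite (fock_alphaE F m).
exact: (bracket_exp_stirling2 (fock_alpha0_dom F) n m HS).
Qed.
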